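(* Let $G$ be a group with a finite symmetric choice of generators $X$. Then $$\gamma^{G,X}=\lambda^{G,X}_g$$ for all $g\in G$.
   Context: A finite choice of generators for $G$ (as a semigroup) is a finite set $X$ of symbols together with a surjective morphism $X^+\to G$, $w\mapsto\overline{w}$, from the free semigroup on $X$ (several symbols may map to the same element). It is symmetric if for every $g\in G$ the same number (possibly $0$) of symbols in $X$ represent $g$ and $g^{-1}$. $|w|$ is the length of a word $w$. For $g\in G$ the local cogrowth function $\lambda^{G,X}_g(n)$ ($n\geq1$) is the number of words of length $n$ in $X^+$ representing $g$, and the local cogrowth rate at $g$ is $\lambda^{G,X}_g=\limsup_{n\to\infty}(\lambda^{G,X}_g(n))^{1/n}$. The global cogrowth function $\gamma^{G,X}(n)$ is the number of pairs $(u,v)$ of non-empty words over $X$ with $|u|+|v|=n$ and $\overline{u}=\overline{v}$, and the global cogrowth rate is $\gamma^{G,X}=\limsup_{n\to\infty}(\gamma^{G,X}(n))^{1/n}$. *)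

(* Defs.v *)
From HB Require Import structures.
From mathcomp Require Import all_boot all_order all_algebra.
From mathcomp Require Import finmap.
From mathcomp Require Import all_classical all_reals all_analysis.

Set Implicit Arguments.
Unset Strict Implicit.
Unset Printing Implicit Defensive.

Local Open Scope classical_set_scope.

(* The free semigroup X^+: non-empty words under concatenation. *)
Record free_semigroup (X : Type) := FreeWord {
  word_seq :> seq X;
  word_seq_neq0 : ~~ nilp word_seq
}.

HB.instance Definition _ (X : Type) := [isSub for @word_seq X].
HB.instance Definition _ (X : choiceType) := [Choice of free_semigroup X by <:].

Section FreeSemigroup.
Variable X : choiceType.
Implicit Types u v w : free_semigroup X.

Fact word_mul_subproof u v : ~~ nilp (u ++ v).
Proof. by case: u => -[]. Qed.

Definition word_mul u v := FreeWord (word_mul_subproof u v).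

Fact word_mulA : associative word_mul.
Proof. by move=> u v w; apply: val_inj; rewrite /= catA. Qed.

HB.instance Definition _ := isSemigroup.Build (free_semigroup X) word_mulA.

End FreeSemigroup.

Definition letter (X : Type) (x : X) : free_semigroup X :=
  @FreeWord X [:: x] isT.

Definition word_length (X : Type) (w : free_semigroup X) : nat :=
  size (word_seq w).

(* A choice of generators is a surjective morphism [bar] from X^+ to G. *)
Section Cogrowth.
Variables (G : groupType) (X : finType).
Variable bar : {multiplicative free_semigroup X -> G}.

Definition is_choice_of_generators : Prop :=
  forall g : G, exists w : free_semigroup X, bar w = g.

Definition is_symmetric_choice : Prop :=
  forall g : G, #|[set x : X | bar (letter x) == g]%SET|
              = #|[set x : X | bar (letter x) == (g^-1)%g]%SET|.

Definition words_representing (g : G) (n : nat) : set (free_semigroup X) :=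
  [set w : free_semigroup X | word_length w = n /\ bar w = g].

Definition equal_word_pairs (n : nat) :
    set (free_semigroup X * free_semigroup X) :=
  [set p : free_semigroup X * free_semigroup X |
     (word_length p.1 + word_length p.2)%N = n /\ bar p.1 = bar p.2].

(* [fset_set A] is a junk value when A is infinite; the finiteness facts
   show that the two cogrowth functions below never meet this case. *)
Fact finite_short_words (n : nat) :
  finite_set [set w : free_semigroup X | (word_length w <= n)%N].
Proof.
have /finite_preimage : {in (@word_seq X) @^-1` (range (@bseqval n X)) &,
  injective (@word_seq X)} by move=> u v _ _ /val_inj.
move=> /(_ (finite_image _ finite_finset)).
by apply: sub_finite_set => w /= wn; exists (Bseq wn).
Qed.

Fact finite_words_representing (g : G) (n : nat) :
  finite_set (words_representing g n).
Proof.
by apply: sub_finite_set (finite_short_words n) => w [/= -> _].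
Qed.

Fact finite_equal_word_pairs (n : nat) : finite_set (equal_word_pairs n).
Proof.
apply: sub_finite_set
  (finite_setX (finite_short_words n) (finite_short_words n)).
by move=> [u v] [/= <- _]; split; rewrite /= ?leq_addr ?leq_addl.
Qed.

Definition local_cogrowth (g : G) (n : nat) : nat :=
  #|` fset_set (words_representing g n)|%fset.

Definition global_cogrowth (n : nat) : nat :=
  #|` fset_set (equal_word_pairs n)|%fset.

End Cogrowth.

(* limsup of the n-th roots of u n, as an extended real; the term of index 0,
   where the exponent 1/n is a junk value, does not affect the limsup. *)
Definition growth_rate (R : realType) (u : nat -> nat) : \bar R :=
  limn_esup (fun n => ((u n)%:R `^ (n%:R)^-1)%:E)%R.

Definition local_cogrowth_rate (R : realType) (G : groupType) (X : finType)
    (bar : {multiplicative free_semigroup X -> G}) (g : G) : \bar R :=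
  growth_rate R (local_cogrowth bar g).

Definition global_cogrowth_rate (R : realType) (G : groupType) (X : finType)
    (bar : {multiplicative free_semigroup X -> G}) : \bar R :=
  growth_rate R (global_cogrowth bar).

(* Main.v *)
Require Import Defs.
From HB Require Import structures.
From mathcomp Require Import all_boot all_order all_algebra.
From mathcomp Require Import finmap.
From mathcomp Require Import all_classical all_reals all_analysis.
From mathcomp Require Import ring.

(** Fix a word [w] with [bar w = g].  Each of the two cogrowth functions is
    bounded by the other one, up to a shift of the argument by [word_length w]
    and a factor at most [n]; neither changes the exponential growth rate.

    A word [u] representing [g] gives the pair [(u, w)] of words with the same
    value, so the local function at [n] is at most the global one at
    [n + word_length w] ([local_cogrowth_le_global]).

    Conversely, symmetry provides a bijection of the letters that inverts their
    values; applying it letter by letter and reversing the word gives an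
    injective, length-preserving operation [iota] on words that inverts their
    values ([inverse_words]).  If [bar u = bar v] then [u], [iota v] and [w]
    concatenate to a word representing [g].  The pair [(u, v)] is recovered from
    this word once the length of [u] is known, and for pairs of total length [n]
    that length has fewer than [n] values ([global_cogrowth_le_local]).

    The analytic part is [growth_rate_mono_shift]: if
    [a n <= n * b (n + k)] for large [n], then the growth rate of [a] is at most
    that of [b]. *)

Set Implicit Arguments.
Unset Strict Implicit.
Unset Printing Implicit Defensive.

Import Order.TTheory GRing.Theory Num.Theory.

Local Open Scope classical_set_scope.

(** * Growth rates *)

Section GrowthRate.
Variable R : realType.
Implicit Types (a b : nat -> nat) (r q K : R).

Local Open Scope ring_scope.

Lemma bernoulli_ineq (h : R) (n : nat) : 0 <= h -> 1 + n%:R * h <= (1 + h) ^+ n.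
Proof.
move=> h0; elim: n => [|n IH]; first by rewrite mul0r addr0 expr0.
rewrite exprS; apply: le_trans (ler_wpM2l (addr_ge0 ler01 h0) IH).
have -> : (1 + h) * (1 + n%:R * h) = 1 + n.+1%:R * h + n%:R * h ^+ 2.
  by rewrite -natr1; ring.
by rewrite lerDl mulr_ge0// sqr_ge0.
Qed.

(** Writing [q = (1 + h) ^+ 2], Bernoulli's inequality bounds [q ^+ n] below by
    [(n%:R * h) ^+ 2], which is quadratic in [n]. *)
Lemma near_linear_le_exp q K : 1 < q -> \forall n \near \oo, n%:R * K <= q ^+ n.
Proof.
move=> q1; pose h := Num.sqrt q - 1.
have h0 : 0 < h by rewrite subr_gt0 -sqrtr1 ltr_sqrt// (lt_trans ltr01).
have qE : q = (1 + h) ^+ 2.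
  by rewrite addrC subrK sqr_sqrtr// (le_trans ler01)// ltW.
near=> n.
have nK : K <= n%:R * h ^+ 2.
  rewrite -ler_pdivrMr ?exprn_gt0//; near: n; exact: nbhs_infty_ger.
rewrite qE -exprM mulnC exprM.
have le_nh : n%:R * h <= (1 + h) ^+ n.
  by apply: le_trans (bernoulli_ineq n (ltW h0)); rewrite lerDr.
apply: (@le_trans _ _ ((n%:R * h) ^+ 2)).
  by rewrite exprMn [n%:R ^+ 2]expr2 -mulrA ler_wpM2l.
have nh0 : 0 <= n%:R * h by rewrite mulr_ge0// ltW.
by rewrite lerXn2r ?nnegrE// (le_trans nh0).
Unshelve. all: by end_near. Qed.

(** This lemma and the next trade the limsup of the roots for geometric bounds
    on the sequence itself.  The bound [r] is positive because roots are
    nonnegative; in particular a growth rate is never [-oo]. *)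
Lemma growth_rate_lt a r : (growth_rate R a < r%:E)%E ->
  0 < r /\ \forall n \near \oo, (a n)%:R <= r ^+ n.
Proof.
rewrite /growth_rate /limn_esup limf_esupE => /ereal_inf_lt[_ [V Voo <-]] supV.
have root_lt n : V n -> (a n)%:R `^ n%:R^-1 < r.
  move=> Vn; rewrite -lte_fin; apply: le_lt_trans supV.
  by apply: ereal_sup_ubound; exists n.
have r0 : 0 < r.
  by have [n /root_lt] := filter_ex Voo; apply: le_lt_trans; exact: powR_ge0.
split=> //; near=> n.
have n0 : (0 < n)%N by near: n; exact: nbhs_infty_gt.
have /root_lt/ltW lt_n : V n by near: n.
(* Index 0 is excluded because the exponent [n%:R^-1] is then 0. *)
have -> : (a n)%:R = ((a n)%:R `^ n%:R^-1) ^+ n :> R.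
  by rewrite -powR_mulrn ?powR_ge0// -powRrM mulVf ?pnatr_eq0 -?lt0n// powRr1.
by rewrite lerXn2r ?nnegrE ?powR_ge0// ltW.
Unshelve. all: by end_near. Qed.

Lemma growth_rate_le a r : 0 <= r ->
  (\forall n \near \oo, (a n)%:R <= r ^+ n) -> (growth_rate R a <= r%:E)%E.
Proof.
move=> r0 le_ar; rewrite /growth_rate /limn_esup limf_esupE.
apply: ge_ereal_inf.
exists (ereal_sup ((fun n => ((a n)%:R `^ n%:R^-1)%:E) @`
   [set n | (0 < n)%N /\ (a n)%:R <= r ^+ n])).
  eexists; last reflexivity.
  near=> n; split; near: n => //; exact: nbhs_infty_gt.
apply: ge_ereal_sup => _ [n [n0 an] <-]; rewrite lee_fin.
have -> : r = (r ^+ n) `^ n%:R^-1.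
  by rewrite -powR_mulrn// -powRrM mulfV ?pnatr_eq0 -?lt0n// powRr1.
by apply: ge0_ler_powR; rewrite ?nnegrE ?exprn_ge0.
Unshelve. all: by end_near. Qed.

(** For [s < t] with [s] above the growth rate of [b], eventually
    [a n <= n * s ^+ (n + k)]; the factor [n * s ^+ k] is absorbed by
    [(t / s) ^+ n], so [a n <= t ^+ n]. *)
Lemma growth_rate_mono_shift a b k :
  (\forall n \near \oo, (a n <= n * b (n + k))%N) ->
  (growth_rate R a <= growth_rate R b)%E.
Proof.
move=> le_ab.
have le_a s t : (growth_rate R b < s%:E)%E -> s < t ->
    (growth_rate R a <= t%:E)%E.
  move=> /growth_rate_lt[s0 b_le] st.
  apply: growth_rate_le; first by rewrite ltW// (lt_trans s0).
  have q1 : 1 < t / s by rewrite ltr_pdivlMr// mul1r.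
  have b_shift_le : \forall n \near \oo, (b (n + k)%N)%:R <= s ^+ (n + k).
    exact: (cvg_addnr k _ b_le).
  near=> n.
  apply: (@le_trans _ _ (n%:R * s ^+ (n + k))).
    apply: (@le_trans _ _ (n * b (n + k)%N)%:R); first by rewrite ler_nat; near: n.
    by rewrite natrM ler_wpM2l//; near: n.
  have : n%:R * s ^+ k <= (t / s) ^+ n by near: n; exact: near_linear_le_exp.
  by rewrite expr_div_n ler_pdivlMr ?exprn_gt0// -mulrA -exprD addnC.
case eb : (growth_rate R b) => [x| |]; last 2 first.
- exact: leey.
- have : (growth_rate R b < 0%:E)%E by rewrite eb ltNy0.
  by move=> /growth_rate_lt[]; rewrite ltxx.
apply/lee_addgt0Pr => e e0; rewrite -EFinD.
apply: (le_a (x + e / 2)).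
  by rewrite eb lte_fin ltrDl divr_gt0.
by rewrite ltrD2l ltr_pdivrMr// mulr_natr mulr2n ltrDl.
Unshelve. all: by end_near. Qed.

End GrowthRate.

(** * Counting words by injections *)

Lemma leq_card_fset_set_in (T U : choiceType) (A : set T) (B : set U)
    (f : T -> U) :
  finite_set A -> finite_set B -> (forall x, A x -> B (f x)) ->
  (forall x y, A x -> A y -> f x = f y -> x = y) ->
  (#|` fset_set A|%fset <= #|` fset_set B|%fset)%N.
Proof.
move=> finA finB fAB finj.
have <- : #|` (f @` fset_set A)|%fset = #|` fset_set A|%fset.
  rewrite card_in_imfset//= => x y.
  by rewrite !in_fset_set// !inE; exact: finj.
apply/fsubset_leq_card/fsubsetP => _ /imfsetP[x /= xA ->].
by move: xA; rewrite !in_fset_set// !inE; exact: fAB.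
Qed.

Section Cogrowth.
Variables (G : groupType) (X : finType).
Variable bar : {multiplicative free_semigroup X -> G}.
Implicit Types (u v w : free_semigroup X) (g : G).

Lemma bar_mul u v : bar (word_mul u v) = (bar u * bar v)%g.
Proof. exact: gmulfM. Qed.

Lemma word_length_mul u v :
  word_length (word_mul u v) = (word_length u + word_length v)%N.
Proof. exact: size_cat. Qed.

Lemma word_length_gt0 u : (0 < word_length u)%N.
Proof. by case: u => -[]. Qed.

Lemma local_cogrowth_le_global g w n : bar w = g ->
  (local_cogrowth bar g n <= global_cogrowth bar (n + word_length w))%N.
Proof.
move=> wg; apply: (@leq_card_fset_set_in _ _ _ _ (fun u => (u, w))).
- exact: finite_words_representing.
- exact: finite_equal_word_pairs.
- by move=> u [<- ug]; split; rewrite /= ?ug ?wg.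
- by move=> u v _ _ [].
Qed.

(** The fibers over [h] and its inverse have the same number of letters, so the
    [i]-th letter over [h] can be sent to the [i]-th letter over the inverse.
    This is injective: the value of the image determines [h], and its position
    determines [i]. *)
Lemma inverse_letters : is_symmetric_choice bar ->
  exists2 sigma : X -> X, injective sigma &
    forall x, bar (letter (sigma x)) = (bar (letter x))^-1%g.
Proof.
move=> sym.
pose fiber g := enum [set x : X | bar (letter x) == g]%SET.
have size_fiber g : size (fiber g) = size (fiber g^-1%g).
  by rewrite -!cardE; exact: sym.
have mem_fiber x g : (x \in fiber g) = (bar (letter x) == g).
  by rewrite mem_enum inE.
pose sigma x :=
  nth x (fiber (bar (letter x))^-1%g) (index x (fiber (bar (letter x)))).
have idx x : (index x (fiber (bar (letter x))) <
              size (fiber (bar (letter x))^-1%g))%N.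
  by rewrite -size_fiber index_mem mem_fiber.
have bar_sigma x : bar (letter (sigma x)) = (bar (letter x))^-1%g.
  by apply/eqP; rewrite -mem_fiber mem_nth.
exists sigma => // x y exy.
have bxy : bar (letter x) = bar (letter y).
  by apply: invg_inj; rewrite -!bar_sigma exy.
have := idx y; have := idx x; move: exy; rewrite /sigma bxy => exy ix iy.
rewrite (set_nth_default y x ix) in exy.
(* Both letters now sit in one fiber, where the image determines the index. *)
move/eqP: exy; rewrite nth_uniq ?enum_uniq// => /eqP eqi.
by apply: (index_inj x _ _ eqi); rewrite mem_fiber ?bxy.
Qed.

Lemma inverse_words : is_symmetric_choice bar ->
  exists iota : free_semigroup X -> free_semigroup X,
    [/\ injective iota, forall u, word_length (iota u) = word_length u &
        forall u, bar (iota u) = (bar u)^-1%g].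
Proof.
move=> /inverse_letters[sigma sigma_inj bar_sigma].
have rev_neq0 u : ~~ nilp (rev (map sigma u)).
  by rewrite /nilp size_rev size_map; case: u.
exists (fun u => FreeWord (rev_neq0 u)); split.
- by move=> u v [] /(can_inj revK)/(inj_map sigma_inj)/val_inj.
- by move=> u; rewrite /word_length /= size_rev size_map.
- case=> s s0 /=; move: (rev_neq0 _) => /=.
  elim: s s0 => [//|x [|y s] IH] s0 r0.
    have -> : FreeWord s0 = letter x by exact: val_inj.
    by rewrite -bar_sigma; congr (bar _); exact: val_inj.
  have -> : FreeWord s0 = word_mul (letter x) (@FreeWord X (y :: s) isT).
    exact: val_inj.
  have r1 : ~~ nilp (rev (map sigma (y :: s))) := rev_neq0 (@FreeWord X (y :: s) isT).
  have -> : FreeWord r0 = word_mul (FreeWord r1) (letter (sigma x)).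
    by apply: val_inj; rewrite /= rev_cons -cats1.
  by rewrite !bar_mul (IH isT) bar_sigma invgM.
Qed.

Lemma global_cogrowth_le_local g w n : is_symmetric_choice bar -> bar w = g ->
  (global_cogrowth bar n <= n * local_cogrowth bar g (n + word_length w))%N.
Proof.
move=> /inverse_words[iota [iota_inj size_iota bar_iota]] wg.
(* On the set [F i] of pairs whose first word has length [i], the map [f] below
   is injective, since it is known where to cut the concatenation. *)
pose F i := [set p | equal_word_pairs bar n p /\ word_length p.1 = i].
have finF i : finite_set (F i).
  by apply: sub_finite_set (finite_equal_word_pairs bar n) => p [].
have trivF : trivIset setT F.
  by move=> i j _ _ [p [[_ <-] [_ <-]]].
have FE : equal_word_pairs bar n = \big[setU/set0]_(i < n) F i.
  rewrite -bigcup_mkord; apply/seteqP; split=> [p pn|p [i _ []//]].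
  exists (word_length p.1) => //=; case: pn => <- _.
  by rewrite -[ltnLHS]addn0 ltn_add2l word_length_gt0.
rewrite /global_cogrowth FE -trivIset_sum_card//.
rewrite -[leqRHS](_ : (\sum_(i < n) local_cogrowth bar g (n + word_length w) = _)%N);
  last by rewrite sum_nat_const card_ord.
apply: leq_sum => i _; move: (nat_of_ord i) => {}i.
pose f (p : free_semigroup X * free_semigroup X) :=
  word_mul (word_mul p.1 (iota p.2)) w.
apply: (leq_card_fset_set_in (f := f)) => //.
- exact: finite_words_representing.
- move=> [u v] [[/= <- uv] _]; split.
    by rewrite /f !word_length_mul size_iota.
  by rewrite /f !bar_mul bar_iota /= uv mulgV mul1g.
- move=> [u v] [u' v'] [[/= n_uv _] ui] [[/= n_uv' _] ui'] /(congr1 val)/= /eqP.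
  rewrite eqseq_cat; last first.
    by rewrite !size_cat -!/(word_length _) !size_iota n_uv.
  rewrite eqxx andbT eqseq_cat; last by rewrite -/(word_length u) ui -ui'.
  by move=> /andP[/eqP/val_inj -> /eqP/val_inj/iota_inj ->].
Qed.

End Cogrowth.

Theorem proposition4p18 (R : realType) (G : groupType) (X : finType)
    (bar : {multiplicative free_semigroup X -> G})
    (bar_surj : is_choice_of_generators bar)
    (bar_sym : is_symmetric_choice bar) :
  forall g : G, global_cogrowth_rate R bar = local_cogrowth_rate R bar g.
Proof.
move=> g; have [w wg] := bar_surj g.
apply/eqP; rewrite eq_le; apply/andP; split.
  apply: (@growth_rate_mono_shift _ _ _ (word_length w)).
  by apply: nearW => n; exact: global_cogrowth_le_local.
apply: (@growth_rate_mono_shift _ _ _ (word_length w)); near=> n.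
have n0 : (0 < n)%N by near: n; exact: nbhs_infty_gt.
apply: leq_trans (local_cogrowth_le_global n wg) _.
by rewrite leq_pmull.
Unshelve. all: by end_near. Qed.
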